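(* Let $1\le k_1\le k_2\le k_3\le k_4$ be integers, let $\lambda$ be the Perron–Frobenius eigenvalue of the 4-star $S(k_1,k_2,k_3,k_4)$ and put $\delta_i=1/R_{k_i}(\lambda)$, $i=1,2,3,4$. Consider the conditions $$(1)\quad \delta_1-\delta_2-\delta_3-\delta_4\le0,\qquad\qquad (2)\quad \delta_1-\delta_2-\delta_3+\delta_4\ge0 .$$ (I) Condition (1) holds if and only if $(k_1,k_2,k_3,k_4)$ is of one of the forms - $(j,j,k,l)$ with $1\le j\le k\le l$, - $(j,j+1,j+1,j+m)$ with $j\ge1$, $m\ge1$, - $(j,j+1,j+2,j+m)$ with $j\ge1$, $2\le m\le4$, - $(j,j+2,j+2,j+2)$ with $j\ge1$. (II) Conditions (1) and (2) both hold if and only if $(k_1,k_2,k_3,k_4)$ is of one of the forms - $(j,j,k,k)$ with $1\le j\le k$, - $(j,j+1,j+1,j+m)$ with $j\ge1$, $1\le m\le3$, - $(1,2,2,5)$, - $(j,j+1,j+2,j+m)$ with $j\ge1$, $2\le m\le4$, - $(j,j+2,j+2,j+2)$ with $j\ge1$.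
   Context: $S(k_1,k_2,k_3,k_4)$ is the tree consisting of a central vertex with four rays attached, the $i$-th ray being a path containing $k_i$ vertices (not counting the central vertex). Its Perron–Frobenius eigenvalue is the largest eigenvalue of its adjacency matrix. The polynomials $R_n$ are defined by $R_0(t)=1$, $R_1(t)=t$, $R_n(t)=tR_{n-1}(t)-R_{n-2}(t)$ for $n\ge2$. *)

(* Defs.v *)
From HB Require Import structures.
From mathcomp Require Import all_boot all_order all_algebra.
From mathcomp Require Import reals.

Set Implicit Arguments.
Unset Strict Implicit.
Unset Printing Implicit Defensive.

Import Order.TTheory GRing.Theory Num.Theory.
Local Open Scope ring_scope.

(* [None] is the central vertex; [Some (Tagged _ a)] with tag [i] is the
   vertex at distance [a.+1] from the centre on the [i]-th ray. *)
Definition star_vertex (n : nat) (k : 'I_n -> nat) : finType :=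
  option {i : 'I_n & 'I_(k i)}.

Definition star_adj (n : nat) (k : 'I_n -> nat) : rel (star_vertex k) :=
  fun u v =>
    match u, v with
    | None, None => false
    | None, Some y => val (tagged y) == 0%N
    | Some x, None => val (tagged x) == 0%N
    | Some x, Some y =>
        (tag x == tag y) &&
        (((val (tagged x)).+1 == val (tagged y)) ||
         ((val (tagged y)).+1 == val (tagged x)))
    end.

Definition adjacency_matrix (R : realType) (V : finType) (e : rel V) :
  'M[R]_#|V| :=
  \matrix_(i, j) (e (enum_val i) (enum_val j))%:R.

Definition star4_rays (k1 k2 k3 k4 : nat) : 'I_4 -> nat :=
  fun i => nth 0%N [:: k1; k2; k3; k4] i.

Definition star4_matrix (R : realType) (k1 k2 k3 k4 : nat) :=
  adjacency_matrix R (@star_adj 4 (star4_rays k1 k2 k3 k4)).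

Definition is_largest_eigenvalue (R : realType) (n : nat) (A : 'M[R]_n)
  (lambda : R) : Prop :=
  eigenvalue A lambda /\ forall mu : R, eigenvalue A mu -> mu <= lambda.

Fixpoint Rpoly (R : realType) (n : nat) : {poly R} :=
  match n with
  | 0 => 1
  | 1 => 'X
  | (m.+1 as p).+1 => 'X * Rpoly R p - Rpoly R m
  end.

(* Main.v *)
Require Import Defs.
From HB Require Import structures.
From mathcomp Require Import all_boot all_order all_algebra.
From mathcomp Require Import reals.
From mathcomp Require Import ring lra zify.

Set Implicit Arguments.
Unset Strict Implicit.
Unset Printing Implicit Defensive.

Import Order.TTheory GRing.Theory Num.Theory.
Local Open Scope ring_scope.

(** Write [g n = R_(n-1)(l) / R_n(l)] for [2 <= l], with [g 0 = 0]
    ([ray_ratio] below).  Along a ray with [k] vertices, an eigenvector for [l]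
    is determined by its value at the centre, and its value next to the centre
    is [g k] times that value.  Hence [l >= 2] is an eigenvalue of a star iff
    [l = \sum_i g (k i)] ([star_eigenvalue_ray_ratio]); the intermediate value
    theorem provides such an [l >= 2] when there are at least four nonempty
    rays, so the largest eigenvalue satisfies this equation.

    Since [(l - g n) * g n.+1 = 1], the equation for four rays becomes
    [g k1.+1 * (g k2 + g k3 + g k4) = 1] ([first_ray_ratio_eq]).  On the other
    hand [delta n = 1 / R_n(l)] satisfies [delta n.+1 = delta n * g n.+1].  Let
    [j = k1], and let [x, y, z, w, u] be the values of [g] at
    [j + 1, ..., j + 5].  For the rays [(j, j + 1, j + 2, j + 4)], for instance,
    the first condition reads [1 <= x + x y + x y z w], and the eigenvalue
    equation [1 = x^2 + x y + x w].  Each family of rays thus gives a polynomial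
    inequality to be derived from one polynomial equation.

    The values of [g] are increasing in [n], smaller than [1], decreasing in
    [l], and bounded by [h] as soon as [h + 1/h <= l].  If all other rays are
    longer than the first one then [3 x^2 <= 1] ([first_ray_ratio_sq]); the
    lower bound [11/20 <= x] always holds ([first_ray_ratio_ge]).  Most
    inequalities follow from these facts alone.  The tighter ones also need a
    lower bound on [l]; since the largest eigenvalue grows with the rays, it is
    enough to test the equation at one rational point for the smallest star of
    the family ([ray_ratio_sum_lower]).

    For the rays [(j, j + 2, j + 2, j + 2)] the equation says exactly that
    [delta j = 3 * delta j.+2], and for [(1, 2, 2, 5)] it forces
    [l^3 = 4 l + 2], which turns the second condition into an equality. *)

(** * Ratios of consecutive polynomials *)

(** [ray_ratio l n] is [R_(n-1)(l) / R_n(l)] (see [Rpoly_gt0_ray_ratio]),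
    defined as a continued fraction.  The value at [n = 0] is [0], that is
    [R_(-1) = 0], which also accounts for an empty ray. *)
Fixpoint ray_ratio (F : realFieldType) (l : F) (n : nat) : F :=
  if n is m.+1 then (l - ray_ratio l m)^-1 else 0.

Lemma ray_ratioE (F : realFieldType) (l : F) n :
  ray_ratio l n.+1 = (l - ray_ratio l n)^-1.
Proof. by []. Qed.

Lemma ray_ratio_itv (F : realFieldType) (l : F) n :
  2 <= l -> 0 <= ray_ratio l n < 1.
Proof.
move=> l2; elim: n => [|n /andP[r0 r1]] /=; first by rewrite lexx ltr01.
by rewrite invr_ge0 invf_lt1 ?subr_gt0 ?subr_ge0 //; lra.
Qed.

Lemma ray_ratio_ge0 (F : realFieldType) (l : F) n :
  2 <= l -> 0 <= ray_ratio l n.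
Proof. by move=> l2; case/andP: (ray_ratio_itv n l2). Qed.

Lemma ray_ratio_lt1 (F : realFieldType) (l : F) n :
  2 <= l -> ray_ratio l n < 1.
Proof. by move=> l2; case/andP: (ray_ratio_itv n l2). Qed.

Lemma ray_ratioS_gt0 (F : realFieldType) (l : F) n :
  2 <= l -> 0 < ray_ratio l n.+1.
Proof.
by move=> l2; rewrite /= invr_gt0 subr_gt0; have r1 := ray_ratio_lt1 n l2; lra.
Qed.

Lemma ray_ratioS (F : realFieldType) (l : F) n :
  2 <= l -> (l - ray_ratio l n) * ray_ratio l n.+1 = 1.
Proof.
move=> l2; have := ray_ratio_lt1 n l2 => r1.
by rewrite /= mulfV // gt_eqF // subr_gt0; lra.
Qed.

Lemma ray_ratio_ltS (F : realFieldType) (l : F) n :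
  2 <= l -> ray_ratio l n < ray_ratio l n.+1.
Proof.
move=> l2; elim: n => [|n IH]; first exact: ray_ratioS_gt0.
have := ray_ratio_lt1 n.+1 l2 => r1.
have r0 := ray_ratio_lt1 n l2.
rewrite [X in X < _]ray_ratioE [X in _ < X]ray_ratioE.
by rewrite ltf_pV2 ?posrE ?subr_gt0; lra.
Qed.

Lemma ray_ratio_lt (F : realFieldType) (l : F) m n :
  2 <= l -> (m < n)%N -> ray_ratio l m < ray_ratio l n.
Proof.
by move=> l2; apply: (homo_ltn lt_trans (fun i => ray_ratio_ltS i l2)).
Qed.

Lemma ray_ratio_le (F : realFieldType) (l : F) m n :
  2 <= l -> (m <= n)%N -> ray_ratio l m <= ray_ratio l n.
Proof.
by move=> l2; rewrite leq_eqVlt => /predU1P[->//|/(ray_ratio_lt l2)/ltW].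
Qed.

Lemma ray_ratio_le_l (F : realFieldType) (l l' : F) n :
  2 <= l -> l <= l' -> ray_ratio l' n <= ray_ratio l n.
Proof.
move=> l2 ll'; elim: n => //= n IH.
have r1 := ray_ratio_lt1 n l2.
have r1' := ray_ratio_lt1 n (le_trans l2 ll').
by rewrite lef_pV2 ?posrE ?subr_gt0; lra.
Qed.

(** For [0 < h <= 1] and [l = h + h^-1], [h] is the limit of [ray_ratio l n]. *)
Lemma ray_ratio_le_bound (F : realFieldType) (l h : F) n :
  2 <= l -> 0 < h -> h + h^-1 <= l -> ray_ratio l n <= h.
Proof.
move=> l2 h0 hl; elim: n => [|n IH]; first exact: ltW.
have := ray_ratio_lt1 n l2 => r1.
rewrite /= -[leRHS]invrK lef_pV2 ?posrE ?invr_gt0 ?subr_gt0 //; last first.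
  by apply: lt_le_trans r1 _; apply: le_trans l2; rewrite ler1n.
by rewrite lerBrDl (le_trans _ hl) // lerD2r.
Qed.

(** One step of a numerical lower estimate: the next ratio is at least any [b]
    below [1 / (l - a)]. *)
Lemma ray_ratioS_ge (F : realFieldType) (l a b : F) n :
  2 <= l -> a <= ray_ratio l n -> 0 <= b -> b * (l - a) <= 1 ->
  b <= ray_ratio l n.+1.
Proof.
move=> l2 ha b0 hb; have r1 := ray_ratio_lt1 n l2.
rewrite ray_ratioE -[leRHS]mul1r ler_pdivlMr ?subr_gt0; last by lra.
by apply: le_trans hb; rewrite ler_wpM2l //; lra.
Qed.

Lemma horner_RpolySS (R : realType) (l : R) n :
  (Rpoly R n.+2).[l] = l * (Rpoly R n.+1).[l] - (Rpoly R n).[l].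
Proof. by rewrite [Rpoly R n.+2]/= hornerD hornerN hornerM hornerX. Qed.

Lemma Rpoly_gt0_ray_ratio (R : realType) (l : R) n :
  2 <= l ->
  0 < (Rpoly R n).[l] /\
  (Rpoly R n).[l] = ray_ratio l n.+1 * (Rpoly R n.+1).[l].
Proof.
move=> l2; elim: n => [|n [R0 E]].
  by rewrite /= hornerC hornerX subr0 mulVf ?gt_eqF //; lra.
have r0 := ray_ratioS_gt0 n l2.
have Rn : 0 < (Rpoly R n.+1).[l] by rewrite -(pmulr_rgt0 _ r0) -E.
split=> //; have rS := ray_ratioS n.+1 l2.
by rewrite horner_RpolySS E -mulrBl mulrA [_ * (l - _)]mulrC rS mul1r.
Qed.

(** * Eigenvalues of a star *)

(** A solution of the three-term recurrence along a ray that vanishes just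
    beyond its end: consecutive values have the expected ratio. *)
Lemma ray_eigenvector_ratio (F : realFieldType) (l : F) (W : nat -> F) k :
  2 <= l -> (forall a, (a < k)%N -> W a + W a.+2 = l * W a.+1) ->
  W k.+1 = 0 -> forall a, (a <= k)%N -> W a.+1 = ray_ratio l (k - a) * W a.
Proof.
move=> l2; elim: k W => [|k IH] W rec W0 a.
  by rewrite leqn0 => /eqP ->; rewrite W0 mul0r.
have {}IH b : (b <= k)%N -> W b.+2 = ray_ratio l (k - b) * W b.+1.
  by move=> bk; apply: (IH (W \o succn)) => //= c ck; apply: rec.
case: a => [_|a ak]; last by rewrite IH.
have := rec 0%N isT; rewrite IH // subn0 => E.
have -> : W 0%N = (l - ray_ratio l k) * W 1%N by rewrite mulrBl -E addrK.
by rewrite subn0 mulrA [ray_ratio l _ * _]mulrC ray_ratioS // mul1r.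
Qed.

(** The sum of [W] over the neighbours of [a] in a path with [k] vertices; the
    right neighbour of the last vertex contributes [W k = 0]. *)
Lemma sum_path_neighbours (F : realFieldType) (W : nat -> F) k a :
  W k = 0 -> (a < k)%N ->
  \sum_(b < k) ((b.+1 == a) || (a.+1 == b))%:R * W b =
  (if a is a'.+1 then W a' else 0) + W a.+1.
Proof.
move=> Wk ak.
have -> : \sum_(b < k) ((b.+1 == a) || (a.+1 == b))%:R * W b =
    \sum_(b < k | b.+1 == a) W b + \sum_(b < k | a.+1 == b) W b.
  rewrite [X in X + _]big_mkcond [X in _ + X]big_mkcond -big_split /=.
  apply: eq_bigr => b _; case: eqP => [<-|_]; case: eqP => /=.
  - by lia.
  - by rewrite mul1r addr0.
  - by rewrite mul1r add0r.
  - by rewrite mul0r addr0.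
congr (_ + _).
  case: a ak => [|a] ak; first by rewrite big_pred0.
  by rewrite (big_pred1 (Ordinal (ltnW ak))) // => b.
have [ak1|] := ltnP a.+1 k.
  by rewrite (big_pred1 (Ordinal ak1)) // => b; rewrite eq_sym.
move=> ka; have -> : a.+1 = k by apply/eqP; rewrite eqn_leq ak.
by rewrite Wk big_pred0 // => b; rewrite gtn_eqF.
Qed.

(** Eigenvectors as functions on the vertices rather than row vectors. *)
Lemma adjacency_eigenP (R : realType) (V : finType) (e : rel V) (mu : R) :
  eigenvalue (adjacency_matrix R e) mu <->
  exists2 w : V -> R, forall u, \sum_v (e v u)%:R * w v = mu * w u &
                      exists v, w v != 0.
Proof.
split.
  case/eigenvalueP=> v Hv /rV0Pn[i vi].
  exists (fun x => v 0 (enum_rank x)); last first.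
    by exists (enum_val i); rewrite enum_valK.
  move=> u; move/rowP/(_ (enum_rank u)): Hv; rewrite !mxE => <-.
  rewrite (reindex (@enum_val V V)) /=; last exact/onW_bij/enum_val_bij.
  by apply: eq_bigr => j _; rewrite mxE enum_valK enum_rankK mulrC.
case=> w Hw [x wx]; apply/eigenvalueP.
exists (\row_i w (enum_val i)); last first.
  by apply/rV0Pn; exists (enum_rank x); rewrite mxE enum_rankK.
apply/rowP=> j; rewrite !mxE -Hw.
rewrite [RHS](reindex (@enum_val V V)) /=; last exact/onW_bij/enum_val_bij.
by apply: eq_bigr => i _; rewrite !mxE mulrC.
Qed.

(** The vertex at distance [a.+1] from the centre on the [i]-th ray. *)
Definition ray_vertex n (k : 'I_n -> nat) (i : 'I_n) (a : 'I_(k i)) :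
  star_vertex k := Some (Tagged (fun i => 'I_(k i)) a).

Arguments ray_vertex {n k} i a.

(** The values of [w] on the [i]-th ray as a function of the distance [d] to the
    centre, extended by [0] beyond the end of the ray. *)
Definition along_ray (F : realFieldType) n (k : 'I_n -> nat)
    (w : star_vertex k -> F) (i : 'I_n) (d : nat) : F :=
  if d is a.+1 then oapp (fun b => w (ray_vertex i b)) 0 (insub a) else w None.

Lemma along_ray_vertex (F : realFieldType) n (k : 'I_n -> nat)
    (w : star_vertex k -> F) (i : 'I_n) (a : 'I_(k i)) :
  along_ray w i a.+1 = w (ray_vertex i a).
Proof. by rewrite /along_ray valK. Qed.

Arguments along_ray_vertex {F n k} w i a.

Lemma along_ray_end (F : realFieldType) n (k : 'I_n -> nat)
    (w : star_vertex k -> F) (i : 'I_n) : along_ray w i (k i).+1 = 0.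
Proof. by rewrite /along_ray insubF ?ltnn. Qed.

Lemma big_star_vertex (F : realFieldType) n (k : 'I_n -> nat)
    (G : star_vertex k -> F) :
  \sum_v G v = G None + \sum_(i < n) \sum_(a < k i) G (ray_vertex i a).
Proof.
rewrite (bigD1 None) //=; congr (_ + _).
rewrite (sig_big_dep _ _ (fun i (a : 'I_(k i)) => G (ray_vertex i a))) /=.
rewrite (reindex_omap Some id) /=; last by case.
by apply: eq_big => [[i a]|[i a] _] //=; rewrite eqxx.
Qed.

Lemma star_center_sum (F : realFieldType) n (k : 'I_n -> nat)
    (w : star_vertex k -> F) :
  \sum_v (star_adj v None)%:R * w v = \sum_i along_ray w i 1.
Proof.
rewrite big_star_vertex /= mul0r add0r; apply: eq_bigr => i _.
case: (posnP (k i)) => [k0|k0].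
  rewrite big1; last by move=> [a ak]; exfalso; lia.
  by rewrite insubF // k0.
rewrite (bigD1 (Ordinal k0)) //= mul1r big1 ?addr0.
  by rewrite -(along_ray_vertex w i (Ordinal k0)).
by move=> a; rewrite -val_eqE /= => /negPf ->; rewrite mul0r.
Qed.

Lemma star_ray_sum (F : realFieldType) n (k : 'I_n -> nat)
    (w : star_vertex k -> F) i (a : 'I_(k i)) :
  \sum_v (star_adj v (ray_vertex i a))%:R * w v =
  along_ray w i a + along_ray w i a.+2.
Proof.
rewrite big_star_vertex /= (bigD1 i) //= [X in _ + (_ + X)]big1; last first.
  move=> i' i'i; rewrite big1 // => b _.
  by rewrite (negPf i'i) mul0r.
have /= S := sum_path_neighbours (W := fun d => along_ray w i d.+1)
  (along_ray_end w i) (ltn_ord a).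
rewrite addr0 eqxx /=.
under eq_bigr => b _ do rewrite -along_ray_vertex.
rewrite S addrA; congr (_ + _).
by case: (nat_of_ord a) => [|a'] /=; rewrite ?mul1r ?mul0r ?addr0 ?add0r.
Qed.

(** The eigenvalue equation of a star.  Restricting to [2 <= mu] makes every
    ratio well defined. *)
Lemma star_eigenvalue_ray_ratio (R : realType) n (k : 'I_n -> nat) (mu : R) :
  2 <= mu ->
  eigenvalue (adjacency_matrix R (@star_adj n k)) mu <->
  mu = \sum_i ray_ratio mu (k i).
Proof.
move=> mu2; split=> [/adjacency_eigenP[w Hw [v wv]] | Hmu].
  have step i a : (a <= k i)%N ->
      along_ray w i a.+1 = ray_ratio mu (k i - a) * along_ray w i a.
    apply: ray_eigenvector_ratio => //; last exact: along_ray_end.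
    move=> b bk; have := star_ray_sum w (Ordinal bk); rewrite /= => <-.
    by rewrite Hw -along_ray_vertex.
  (* If the centre carries 0, so does each ray, vertex after vertex. *)
  have w0 : w None != 0.
    apply: contra wv => /eqP w0.
    have W0 i a : (a <= (k i).+1)%N -> along_ray w i a = 0.
      elim: a => [|a IH] ak //; rewrite step // IH ?mulr0 //.
      exact: ltnW.
    case: v => [[i a]|]; last by rewrite w0.
    by rewrite -[Some _]/(ray_vertex i a) -along_ray_vertex W0 // ltnS ltnW.
  apply: (mulIf w0); rewrite -(Hw None) star_center_sum mulr_suml.
  by apply: eq_bigr => i _; rewrite step // subn0.
(* Conversely, start with 1 at the centre and multiply by the ratios. *)
pose P i a := \prod_(b < a) ray_ratio mu (k i - b).
pose w (v : star_vertex k) : R :=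
  if v is Some p then P (tag p) (tagged p).+1 else 1.
have wE i a : (a <= (k i).+1)%N -> along_ray w i a = P i a.
  case: a => [|a]; first by rewrite /P big_ord0.
  rewrite ltnS leq_eqVlt => /predU1P[->|ak].
    by rewrite along_ray_end /P big_ord_recr /= subnn mulr0.
  by rewrite -[a]/(nat_of_ord (Ordinal ak)) along_ray_vertex.
apply/adjacency_eigenP; exists w; last by exists None; apply: oner_neq0.
case=> [[i a]|].
  rewrite -[Some _]/(ray_vertex i a) star_ray_sum -along_ray_vertex.
  have ak := ltn_ord a.
  rewrite (wE i a) ?(leqW (ltnW ak)) // !wE ?ltnS ?(ltnW ak) //.
  have -> : P i a.+2 =
      P i a * ray_ratio mu (k i - a) * ray_ratio mu (k i - a.+1).
    by rewrite /P !big_ord_recr.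
  have -> : P i a.+1 = P i a * ray_ratio mu (k i - a).
    by rewrite /P big_ord_recr.
  rewrite -(subnSK ak); have := ray_ratioS (k i - a.+1) mu2.
  move: (ray_ratio mu _.+1) => r E.
  by rewrite -[X in X + _]mulr1 -E; ring.
rewrite (star_center_sum w) mulr1 [RHS]Hmu; apply: eq_bigr => i _.
by rewrite wE // /P big_ord1 subn0.
Qed.

(** For polynomials [D > 0] and [N], [mu - \sum_i ray_ratio mu (k i)] is
    [('X * D - N) / D] at [mu].  It is nonpositive at [2], where each ratio is
    at least [1/2], and nonnegative at the number [n] of rays, as ratios are
    less than [1]. *)
Lemma star_eigenvalue_exists (R : realType) n (k : 'I_n -> nat) :
  (4 <= n)%N -> (forall i, (0 < k i)%N) ->
  exists2 mu : R, 2 <= mu & eigenvalue (adjacency_matrix R (@star_adj n k)) mu.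
Proof.
move=> n4 k0.
pose D := \prod_i Rpoly R (k i).
pose N := \sum_i Rpoly R (k i).-1 * \prod_(j | j != i) Rpoly R (k j).
have DN (l : R) : 2 <= l ->
    0 < D.[l] /\ N.[l] = D.[l] * \sum_i ray_ratio l (k i).
  move=> l2; have Rp m : 0 < (Rpoly R m).[l].
    by case: (Rpoly_gt0_ray_ratio m l2).
  split; first by rewrite horner_prod prodr_gt0.
  rewrite horner_sum mulr_sumr; apply: eq_bigr => i _.
  rewrite hornerM !horner_prod [in RHS](bigD1 i) //=.
  have [_ ->] := Rpoly_gt0_ray_ratio (k i).-1 l2.
  by rewrite prednK //; ring.
pose p := 'X * D - N.
have pE (l : R) : 2 <= l -> p.[l] = D.[l] * (l - \sum_i ray_ratio l (k i)).
  move=> l2; have [_ E] := DN l l2.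
  by rewrite hornerD hornerN hornerM hornerX E; ring.
have n2 : (2 : R) <= n%:R by rewrite ler_nat (leq_trans _ n4).
have [|mu /andP[mu2 _] /eqP pmu] := @poly_ivt _ p 2 n%:R n2.
- rewrite pE // pE //; have [D2 _] := DN _ (lexx 2); have [Dn _] := DN _ n2.
  rewrite pmulr_rle0 // pmulr_rge0 // subr_le0 subr_ge0; apply/andP; split.
    have : \sum_(i < n) ray_ratio (2 : R) 1 <= \sum_i ray_ratio 2 (k i).
      by apply: ler_sum => i _; apply: ray_ratio_le (k0 i).
    apply: le_trans; rewrite sumr_const card_ord /= subr0 -[_ *+ n]mulr_natl.
    by rewrite ler_pdivlMr // -natrM ler_nat (leq_trans _ n4).
  rewrite -[X in _ <= X%:R](card_ord n) -sumr_const; apply: ler_sum => i _.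
  exact/ltW/ray_ratio_lt1.
exists mu => //; apply/star_eigenvalue_ray_ratio => //.
have [Dmu _] := DN _ mu2; move: pmu; rewrite pE // => /eqP.
by rewrite mulf_eq0 gt_eqF //= subr_eq0 => /eqP.
Qed.

(** * The eigenvalue equation of a star with four rays *)

Lemma star4_largest_eigenvalue (R : realType) (k1 k2 k3 k4 : nat) (l : R) :
  (0 < k1)%N -> (0 < k2)%N -> (0 < k3)%N -> (0 < k4)%N ->
  is_largest_eigenvalue (star4_matrix R k1 k2 k3 k4) l ->
  2 <= l /\
  l = ray_ratio l k1 + ray_ratio l k2 + ray_ratio l k3 + ray_ratio l k4.
Proof.
move=> k1p k2p k3p k4p [El maxl].
have kp i : (0 < star4_rays k1 k2 k3 k4 i)%N by case: i => [[|[|[|[|]]]]].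
have [mu mu2 Emu] := star_eigenvalue_exists R (leqnn 4) kp.
have l2 : 2 <= l by apply: le_trans mu2 (maxl _ Emu).
split=> //; move: El => /(star_eigenvalue_ray_ratio _ l2) {1}->.
by rewrite !big_ord_recr big_ord0 /= add0r.
Qed.

(** Monotonicity of the largest eigenvalue in the rays, in a testable form: if
    the sum of the ratios for the smaller star [(a1, a2, a3, a4)] is at least
    [l0] at [l0], then [l0] is a lower bound for the eigenvalue of the larger
    star. *)
Lemma ray_ratio_sum_lower (F : realFieldType) (l0 l : F)
    (k1 k2 k3 k4 a1 a2 a3 a4 : nat) :
  2 <= l0 -> 2 <= l ->
  l0 <= ray_ratio l0 a1 + ray_ratio l0 a2 + ray_ratio l0 a3 + ray_ratio l0 a4 ->
  (a1 <= k1)%N -> (a2 <= k2)%N -> (a3 <= k3)%N -> (a4 <= k4)%N ->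
  l = ray_ratio l k1 + ray_ratio l k2 + ray_ratio l k3 + ray_ratio l k4 ->
  l0 <= l.
Proof.
move=> l02 l2 h0 h1 h2 h3 h4 hl; case: (leP l0 l) => // ll0.
have b a k : (a <= k)%N -> ray_ratio l0 a <= ray_ratio l k.
  move=> ak; apply: le_trans (ray_ratio_le l2 ak).
  exact: ray_ratio_le_l (ltW ll0).
have := b _ _ h1; have := b _ _ h2; have := b _ _ h3; have := b _ _ h4.
by move: hl; lra.
Qed.

Lemma first_ray_ratio_eq (F : realFieldType) (l : F) (k1 k2 k3 k4 : nat) :
  2 <= l ->
  l = ray_ratio l k1 + ray_ratio l k2 + ray_ratio l k3 + ray_ratio l k4 ->
  ray_ratio l k1.+1 * (ray_ratio l k2 + ray_ratio l k3 + ray_ratio l k4) = 1.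
Proof.
move=> l2 hl; rewrite -(ray_ratioS k1 l2) mulrC; congr (_ * _).
by move: hl; lra.
Qed.

Lemma first_ray_ratio_sq (F : realFieldType) (l : F) (k1 k2 k3 k4 : nat) :
  2 <= l -> (k1 < k2)%N -> (k1 < k3)%N -> (k1 < k4)%N ->
  l = ray_ratio l k1 + ray_ratio l k2 + ray_ratio l k3 + ray_ratio l k4 ->
  3 * ray_ratio l k1.+1 ^+ 2 <= 1.
Proof.
move=> l2 h2 h3 h4 /(first_ray_ratio_eq l2).
have := ray_ratioS_gt0 k1 l2; have := ray_ratio_le l2 h2.
have := ray_ratio_le l2 h3.
have := ray_ratio_le l2 h4.
move: (ray_ratio l k1.+1) (ray_ratio l k2) (ray_ratio l k3) (ray_ratio l k4).
by move=> x a b c; nra.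
Qed.

(** Both [l - 1/l] and [3 h], where [h] bounds the ratios at [l = h + 1/h], are
    upper bounds for the inverse of the ratio.  The first one increases with
    [l], the second one decreases, and at [l = 20/33 + 33/20] both are at most
    [20/11]. *)
Lemma first_ray_ratio_ge (F : realFieldType) (l : F) (k1 k2 k3 k4 : nat) :
  2 <= l -> (0 < k1)%N ->
  l = ray_ratio l k1 + ray_ratio l k2 + ray_ratio l k3 + ray_ratio l k4 ->
  11/20 <= ray_ratio l k1.+1.
Proof.
move=> l2 k1p hl; have x0 := ray_ratioS_gt0 k1 l2.
case: (leP l (20/33 + 33/20)) => hll.
  have r1 : 11/25 <= ray_ratio l 1.
    by apply: (ray_ratioS_ge (n := 0) (a := 0)) => //; lra.
  have := ray_ratio_le l2 k1p; have := ray_ratioS k1 l2.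
  move: x0 r1; move: (ray_ratio l k1.+1) (ray_ratio l k1) (ray_ratio l 1).
  by move=> x a b *; nra.
have b n : ray_ratio l n <= 20/33.
  by apply: ray_ratio_le_bound => //; [lra | rewrite invf_div ltW].
have := first_ray_ratio_eq l2 hl; have := b k2; have := b k3; have := b k4.
move: x0; move: (ray_ratio l k1.+1) (ray_ratio l k2) (ray_ratio l k3).
move: (ray_ratio l k4).
by move=> d x a c *; nra.
Qed.

(** * The two conditions for each family of rays *)

(** The number attached to a ray with [n] vertices.  In the lemmas that follow,
    [cond1] stands for [delta_1 - delta_2 - delta_3 - delta_4 <= 0], [cond2] for
    [0 <= delta_1 - delta_2 - delta_3 + delta_4], and a name like
    [cond1_j_j1_j2_j4] lists the rays [j], [j + 1], [j + 2], [j + 4].  In the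
    proofs, [x], [y], [z], [w], [u] are the ratios at [j + 1], ..., [j + 5], and
    [E] is the eigenvalue equation. *)
Definition Rdelta (R : realType) (l : R) n : R := 1 / (Rpoly R n).[l].

Lemma Rdelta_gt0 (R : realType) (l : R) n : 2 <= l -> 0 < Rdelta l n.
Proof. by move=> l2; rewrite divr_gt0 //; case: (Rpoly_gt0_ray_ratio n l2). Qed.

Lemma RdeltaS (R : realType) (l : R) n :
  2 <= l -> Rdelta l n.+1 = Rdelta l n * ray_ratio l n.+1.
Proof.
move=> l2; have [_ E] := Rpoly_gt0_ray_ratio n l2.
have [p _] := Rpoly_gt0_ray_ratio n.+1 l2; have r := ray_ratioS_gt0 n l2.
by rewrite /Rdelta E; field; rewrite !gt_eqF.
Qed.

Lemma Rdelta_gt (R : realType) (l : R) m n :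
  2 <= l -> (m < n)%N -> Rdelta l n < Rdelta l m.
Proof.
move=> l2; apply: (homo_ltn (r := fun x y => y < x)) => [y x z xy yz|i].
  exact: lt_trans yz xy.
by rewrite RdeltaS // gtr_pMr ?Rdelta_gt0 ?ray_ratio_lt1.
Qed.

Lemma Rdelta_ge (R : realType) (l : R) m n :
  2 <= l -> (m <= n)%N -> Rdelta l n <= Rdelta l m.
Proof.
by move=> l2; rewrite leq_eqVlt => /predU1P[->//|/(Rdelta_gt l2)/ltW].
Qed.

(** As [E] reads [1 = x (2 x + g)], where [g < 1] is the ratio of the last ray,
    already [1 <= 2 x]. *)
Lemma cond1_j_j1_j1 (R : realType) (l : R) (j m : nat) :
  2 <= l ->
  l = ray_ratio l j + ray_ratio l j.+1 + ray_ratio l j.+1 + ray_ratio l m ->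
  Rdelta l j - Rdelta l j.+1 - Rdelta l j.+1 - Rdelta l m <= 0.
Proof.
move=> l2 /(first_ray_ratio_eq l2); rewrite RdeltaS //.
have := ray_ratio_lt1 m l2; have := ray_ratioS_gt0 j l2.
have := Rdelta_gt0 j l2; have := Rdelta_gt0 m l2.
move: (ray_ratio l j.+1) (ray_ratio l m) (Rdelta l j) (Rdelta l m) => x g d e.
move=> e0 d0 x0 g1 E; have xh : 1 <= 2 * x by nra.
by nra.
Qed.

(** Up to the factor [delta j], the expression is at least
    [1 - 2 x + x^3 = (1 - x) (1 - x - x^2)]. *)
Lemma cond2_j_j1_j1 (R : realType) (l : R) (j m : nat) :
  2 <= l -> (j < m <= j.+3)%N ->
  l = ray_ratio l j + ray_ratio l j.+1 + ray_ratio l j.+1 + ray_ratio l m ->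
  0 <= Rdelta l j - Rdelta l j.+1 - Rdelta l j.+1 + Rdelta l m.
Proof.
move=> l2 /andP[jm mj3] hl.
have := first_ray_ratio_sq l2 (ltnSn j) (ltnSn j) jm hl.
have := Rdelta_ge l2 mj3; rewrite !RdeltaS //.
have := ray_ratioS_gt0 j l2; have := ray_ratio_ltS j.+1 l2.
have := ray_ratio_ltS j.+2 l2.
have := Rdelta_gt0 j l2; move: (Rdelta l m) (Rdelta l j) => e d.
move: (ray_ratio l j.+1) (ray_ratio l j.+2) (ray_ratio l j.+3) => x y z.
move=> d0 yz xy x0 he x2.
have xyz : x ^+ 3 <= x * y * z.
  rewrite -mulrA exprS ler_pM2l // expr2.
  by apply: ler_pM; lra.
have x3 : 5 * x <= 3 by nra.
have c : 0 <= 1 - 2 * x + x ^+ 3.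
  have -> : 1 - 2 * x + x ^+ 3 = (1 - x) * (1 - x - x ^+ 2) by ring.
  by apply: mulr_ge0; nra.
have : 0 <= d * (1 - 2 * x + x * y * z) by apply: mulr_ge0; lra.
by move: he; lra.
Qed.

(** Testing the star [(1, 2, 2, 6)] shows that [16/25 + 25/16 <= l], so that all
    ratios are at most [16/25]; the equation [1 = x (2 x + g)], with [g] the
    ratio of the last ray, then bounds [x] from below. *)
Lemma not_cond2_j_j1_j1_ge5 (R : realType) (l : R) (j m : nat) :
  2 <= l -> (0 < j)%N -> (j + 5 <= m)%N ->
  l = ray_ratio l j + ray_ratio l j.+1 + ray_ratio l j.+1 + ray_ratio l m ->
  Rdelta l j - Rdelta l j.+1 - Rdelta l j.+1 + Rdelta l m < 0.
Proof.
move=> l2 j0 jm hl.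
have l0 : 16/25 + 25/16 <= l.
  have m6 : (6 <= m)%N by lia.
  apply: (ray_ratio_sum_lower (a1 := 1) (a2 := 2) (a3 := 2) _ _ _ _ _ _ m6 hl);
    rewrite //.
    by lra.
  have r1 : 453/1000 <= ray_ratio (16/25 + 25/16 : R) 1.
    by apply: (ray_ratioS_ge (n := 0) (a := 0)); rewrite //=; lra.
  have r2 : 571/1000 <= ray_ratio (16/25 + 25/16 : R) 2.
    by apply: ray_ratioS_ge r1 _ _; lra.
  have r6 : 612/1000 <= ray_ratio (16/25 + 25/16 : R) 6.
    apply: le_trans (ray_ratio_le (m := 3) _ _); rewrite //; last by lra.
    by apply: ray_ratioS_ge r2 _ _; lra.
  by lra.
have h n : ray_ratio l n <= 16/25.
  by apply: ray_ratio_le_bound => //; [lra | rewrite invf_div].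
have := first_ray_ratio_eq l2 hl; have := ray_ratioS_gt0 j l2.
have := Rdelta_gt0 j l2; have := Rdelta_ge l2 jm.
rewrite !addnS addn0 !RdeltaS //.
have := h m; have := h j.+2; have := h j.+3; have := h j.+4; have := h j.+4.+1.
have := ray_ratioS_gt0 j.+1 l2; have := ray_ratioS_gt0 j.+2 l2.
have := ray_ratioS_gt0 j.+3 l2; have := ray_ratioS_gt0 j.+4 l2.
move: (Rdelta l m) (Rdelta l j) (ray_ratio l m) => e d g.
move: (ray_ratio l j.+1) (ray_ratio l j.+2) (ray_ratio l j.+3) => x y z.
move: (ray_ratio l j.+4) (ray_ratio l j.+4.+1) => w u.
move=> u0 w0 z0 y0 u1 w1 z1 y1 g1 he d0 x0 E.
have yz : y * z <= 16/25 * (16/25) by apply: ler_pM; lra.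
have wu : w * u <= 16/25 * (16/25) by apply: ler_pM; lra.
have q : (y * z) * (w * u) <= 17/100.
  have : (y * z) * (w * u) <= 16/25 * (16/25) * (16/25 * (16/25)).
    by apply: ler_pM => //; rewrite mulr_ge0 // ltW.
  by lra.
have xg : 1 <= x * (2 * x + 16/25).
  by rewrite -[leLHS]E ler_pM2l //; lra.
have xb : 56/100 <= x.
  by rewrite leNgt; apply/negP => xs; clear -x0 xg xs; nra.
have q1 : x * (2 - (y * z) * (w * u)) > 1 by nra.
have : 0 < d * (x * (2 - (y * z) * (w * u)) - 1).
  by rewrite mulr_gt0 // subr_gt0.
by move: he; nra.
Qed.

(** The same argument with the star [(2, 3, 3, 6)] and ratios at most [3/5]. *)
Lemma not_cond2_j_j1_j1_ge4 (R : realType) (l : R) (j m : nat) :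
  2 <= l -> (1 < j)%N -> (j + 4 <= m)%N ->
  l = ray_ratio l j + ray_ratio l j.+1 + ray_ratio l j.+1 + ray_ratio l m ->
  Rdelta l j - Rdelta l j.+1 - Rdelta l j.+1 + Rdelta l m < 0.
Proof.
move=> l2 j0 jm hl.
have l0 : 3/5 + 5/3 <= l.
  have m6 : (6 <= m)%N by lia.
  apply: (ray_ratio_sum_lower (a1 := 2) (a2 := 3) (a3 := 3) _ _ _ _ _ _ m6 hl);
    rewrite //.
    by lra.
  have r1 : 44/100 <= ray_ratio (3/5 + 5/3 : R) 1.
    by apply: (ray_ratioS_ge (n := 0) (a := 0)); rewrite //=; lra.
  have r2 : 547/1000 <= ray_ratio (3/5 + 5/3 : R) 2.
    by apply: ray_ratioS_ge r1 _ _; lra.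
  have r3 : 58/100 <= ray_ratio (3/5 + 5/3 : R) 3.
    by apply: ray_ratioS_ge r2 _ _; lra.
  have r6 : 58/100 <= ray_ratio (3/5 + 5/3 : R) 6.
    by apply: le_trans r3 (ray_ratio_le _ _); rewrite //; lra.
  by lra.
have h n : ray_ratio l n <= 3/5.
  by apply: ray_ratio_le_bound => //; [lra | rewrite invf_div].
have := first_ray_ratio_eq l2 hl; have := ray_ratioS_gt0 j l2.
have := Rdelta_gt0 j l2; have := Rdelta_ge l2 jm.
rewrite !addnS addn0 !RdeltaS //.
have := h m; have := h j.+2; have := h j.+3; have := h j.+4.
have := ray_ratioS_gt0 j.+1 l2; have := ray_ratioS_gt0 j.+2 l2.
have := ray_ratioS_gt0 j.+3 l2.
move: (Rdelta l m) (Rdelta l j) (ray_ratio l m) => e d g.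
move: (ray_ratio l j.+1) (ray_ratio l j.+2) (ray_ratio l j.+3) => x y z.
move: (ray_ratio l j.+4) => w.
move=> w0 z0 y0 w1 z1 y1 g1 he d0 x0 E.
have yz : y * z <= 3/5 * (3/5) by apply: ler_pM; lra.
have q : y * z * w <= 22/100.
  have : y * z * w <= 3/5 * (3/5) * (3/5).
    by apply: ler_pM => //; rewrite ?mulr_ge0 // ltW.
  by lra.
have xg : 1 <= x * (2 * x + 3/5).
  by rewrite -[leLHS]E ler_pM2l //; lra.
have xb : 57/100 <= x.
  by rewrite leNgt; apply/negP => xs; clear -x0 xg xs; nra.
have q1 : x * (2 - y * z * w) > 1 by nra.
have : 0 < d * (x * (2 - y * z * w) - 1).
  by rewrite mulr_gt0 // subr_gt0.
by move: he; nra.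
Qed.

(** The eigenvalue equation factors as
    [(l^3 - 4 l - 2) (l^3 - 4 l + 2) = 0], and the first factor divides the
    numerator of the expression. *)
Lemma cond2_1225 (R : realType) (l : R) :
  2 <= l ->
  l = ray_ratio l 1 + ray_ratio l 2 + ray_ratio l 2 + ray_ratio l 5 ->
  Rdelta l 1 - Rdelta l 2 - Rdelta l 2 + Rdelta l 5 = 0.
Proof.
move=> l2 hl; have := first_ray_ratio_eq l2 hl.
have [p1 E1] := Rpoly_gt0_ray_ratio 1 l2.
have [p2 _] := Rpoly_gt0_ray_ratio 2 l2.
have [p4 E4] := Rpoly_gt0_ray_ratio 4 l2.
have [p5 _] := Rpoly_gt0_ray_ratio 5 l2.
rewrite /Rdelta; move: p1 E1 p2 p4 E4 p5.
have P0 : (Rpoly R 0).[l] = 1 by rewrite hornerC.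
have P1 : (Rpoly R 1).[l] = l by rewrite hornerX.
rewrite P1.
have -> : (Rpoly R 2).[l] = l ^+ 2 - 1.
  by rewrite !horner_RpolySS P1 P0; ring.
have -> : (Rpoly R 4).[l] = l ^+ 4 - 3 * l ^+ 2 + 1.
  by rewrite !horner_RpolySS P1 P0; ring.
have -> : (Rpoly R 5).[l] = l * (l ^+ 2 - 1) * (l ^+ 2 - 3).
  by rewrite !horner_RpolySS P1 P0; ring.
move=> p1 E1 p2 p4 E4 p5 E.
have q : 0 < l ^+ 2 - 3 by rewrite -(pmulr_rgt0 _ (mulr_gt0 p1 p2)).
have lE : (l ^+ 3 - 4 * l - 2) * (l ^+ 3 - 4 * l + 2) = 0.
  have : (ray_ratio l 2 * (l ^+ 2 - 1)) *
      (2 * (ray_ratio l 2 * (l ^+ 2 - 1)) * (l * (l ^+ 2 - 3)) +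
       ray_ratio l 5 * (l * (l ^+ 2 - 1) * (l ^+ 2 - 3))) =
      l * (l ^+ 2 - 1) ^+ 2 * (l ^+ 2 - 3).
    by rewrite -[RHS]mulr1 -[X in _ = _ * X]E; ring.
  rewrite -E1 -E4 => E'; apply: (mulfI (lt0r_neq0 p1)).
  by rewrite mulr0; move: E'; lra.
have {lE} lE : l ^+ 3 = 4 * l + 2.
  move/eqP: lE; rewrite mulf_eq0 => /orP[] /eqP; first lra.
  by nra.
have -> : 1 / l - 1 / (l ^+ 2 - 1) - 1 / (l ^+ 2 - 1) +
    1 / (l * (l ^+ 2 - 1) * (l ^+ 2 - 3)) =
    (l - 2) * (l ^+ 3 - 4 * l - 2) / (l * (l ^+ 2 - 1) * (l ^+ 2 - 3)).
  by field; rewrite !gt_eqF.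
by rewrite lE; field; rewrite !gt_eqF.
Qed.

Lemma cond1_j_j1_j2_j2 (R : realType) (l : R) (j : nat) :
  2 <= l ->
  l = ray_ratio l j + ray_ratio l j.+1 + ray_ratio l j.+2 + ray_ratio l j.+2 ->
  Rdelta l j - Rdelta l j.+1 - Rdelta l j.+2 - Rdelta l j.+2 <= 0.
Proof.
move=> l2 /(first_ray_ratio_eq l2); rewrite !RdeltaS //.
have := ray_ratio_lt1 j.+1 l2; have := ray_ratioS_gt0 j l2.
have := Rdelta_gt0 j l2.
move: (Rdelta l j) (ray_ratio l j.+1) (ray_ratio l j.+2) => d x y d0 x0 x1 E.
have : 0 <= d * (x + x * y + x * y - 1) by apply: mulr_ge0; nra.
by lra.
Qed.

Lemma cond1_j_j1_j2_j3 (R : realType) (l : R) (j : nat) :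
  2 <= l ->
  l = ray_ratio l j + ray_ratio l j.+1 + ray_ratio l j.+2 + ray_ratio l j.+3 ->
  Rdelta l j - Rdelta l j.+1 - Rdelta l j.+2 - Rdelta l j.+3 <= 0.
Proof.
move=> l2 /(first_ray_ratio_eq l2); rewrite !RdeltaS //.
have := ray_ratio_ltS j.+1 l2; have := ray_ratioS_gt0 j l2.
have := Rdelta_gt0 j l2.
have := ray_ratio_lt1 j.+1 l2; have := ray_ratio_lt1 j.+3 l2.
have := ray_ratioS_gt0 j.+2 l2.
move: (Rdelta l j) (ray_ratio l j.+1) (ray_ratio l j.+2) (ray_ratio l j.+3).
move=> d x y z z0 z1 x1 d0 x0 xy E.
have q : x + z <= 1 + y * z.
  have : 0 <= (1 - z) * (1 - x) by apply: mulr_ge0; lra.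
  have : x * z <= y * z by rewrite ler_pM2r // ltW.
  by lra.
have : 0 <= d * (x * (1 + y * z - x - z)).
  by rewrite mulr_ge0 ?(ltW d0) // mulr_ge0 ?(ltW x0) //; lra.
have <- : x + x * y + x * y * z - 1 = x * (1 + y * z - x - z).
  by rewrite -[X in _ - X]E; ring.
by lra.
Qed.

(** By [E], the condition amounts to [x + w <= 1 + y z w], which follows from
    [w (1 + x) <= 1] because [y z >= x^2].  The bound [w <= 5/8] comes from the
    star [(1, 2, 3, 5)]. *)
Lemma cond1_j_j1_j2_j4 (R : realType) (l : R) (j : nat) :
  2 <= l -> (0 < j)%N ->
  l = ray_ratio l j + ray_ratio l j.+1 + ray_ratio l j.+2 + ray_ratio l j.+4 ->
  Rdelta l j - Rdelta l j.+1 - Rdelta l j.+2 - Rdelta l j.+4 <= 0.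
Proof.
move=> l2 j0 hl.
have l0 : 5/8 + 8/5 <= l.
  apply: (ray_ratio_sum_lower (a1 := 1) (a2 := 2) (a3 := 3) (a4 := 5)) hl => //.
    by lra.
  have r1 : 449/1000 <= ray_ratio (5/8 + 8/5 : R) 1.
    by apply: (ray_ratioS_ge (n := 0) (a := 0)); rewrite //=; lra.
  have r2 : 563/1000 <= ray_ratio (5/8 + 8/5 : R) 2.
    by apply: ray_ratioS_ge r1 _ _; lra.
  have r3 : 601/1000 <= ray_ratio (5/8 + 8/5 : R) 3.
    by apply: ray_ratioS_ge r2 _ _; lra.
  have r4 : 615/1000 <= ray_ratio (5/8 + 8/5 : R) 4.
    by apply: ray_ratioS_ge r3 _ _; lra.
  have r5 : 615/1000 <= ray_ratio (5/8 + 8/5 : R) 5.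
    by apply: le_trans r4 (ray_ratio_le _ _); rewrite //; lra.
  by lra.
have w1 : ray_ratio l j.+4 <= 5/8.
  by apply: ray_ratio_le_bound => //; [lra | rewrite invf_div].
have j14 : (j < j.+4)%N by lia.
have := first_ray_ratio_sq l2 (ltnSn j) (leqnSn j.+1) j14 hl.
have := first_ray_ratio_eq l2 hl; rewrite !RdeltaS //.
have := ray_ratio_ltS j.+1 l2; have := ray_ratio_ltS j.+2 l2.
have := ray_ratioS_gt0 j l2; have := Rdelta_gt0 j l2.
have := ray_ratioS_gt0 j.+3 l2.
move: w1; move: (ray_ratio l j.+1) (ray_ratio l j.+2) (ray_ratio l j.+3).
move: (Rdelta l j) (ray_ratio l j.+4) => d w x y z w1 w0 d0 x0 yz xy E x2.
have q1 : x ^+ 2 <= y * z by nra.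
have q2 : w * (1 + x) <= 1 by nra.
have q : x + w <= 1 + y * z * w.
  have : 0 <= (1 - x) * (1 - w * (1 + x)) by apply: mulr_ge0; nra.
  by nra.
have : 0 <= d * (x + x * y + x * (y * z * w) - 1) by apply: mulr_ge0; nra.
by lra.
Qed.

(** By [E], [x^2 + 2 x y <= 1], hence [x + x y <= 1] as [0 <= (1 - x)^2]. *)
Lemma cond2_j_j1_j2 (R : realType) (l : R) (j m : nat) :
  2 <= l -> (j.+2 <= m)%N ->
  l = ray_ratio l j + ray_ratio l j.+1 + ray_ratio l j.+2 + ray_ratio l m ->
  0 <= Rdelta l j - Rdelta l j.+1 - Rdelta l j.+2 + Rdelta l m.
Proof.
move=> l2 jm /(first_ray_ratio_eq l2); have := ray_ratio_le l2 jm.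
have := Rdelta_gt0 m l2; rewrite !RdeltaS //.
have := ray_ratioS_gt0 j l2; have := Rdelta_gt0 j l2.
move: (Rdelta l j) (ray_ratio l j.+1) (ray_ratio l j.+2) (ray_ratio l m).
move: (Rdelta l m) => e d x y g d0 x0 e0 yg E.
have q1 : x * (x + 2 * y) <= 1.
  by rewrite -[leRHS]E ler_pM2l //; lra.
have q : x + x * y <= 1.
  have := sqr_ge0 (1 - x); rewrite expr2; lra.
have : 0 <= d * (1 - x - x * y) by apply: mulr_ge0; lra.
by lra.
Qed.

(** By [E], it suffices that [1 + u^4 < x + u]; the bounds [11/20 <= x <= u] and
    [E] confine [u] to the interval from [11/20] to [18/25]. *)
Lemma not_cond1_j_j1_j2 (R : realType) (l : R) (j m : nat) :
  2 <= l -> (0 < j)%N -> (j + 5 <= m)%N ->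
  l = ray_ratio l j + ray_ratio l j.+1 + ray_ratio l j.+2 + ray_ratio l m ->
  0 < Rdelta l j - Rdelta l j.+1 - Rdelta l j.+2 - Rdelta l m.
Proof.
move=> l2 j0 jm hl; have x1 := first_ray_ratio_ge l2 j0 hl.
have := first_ray_ratio_eq l2 hl; have := ray_ratio_le l2 jm.
have := Rdelta_ge l2 jm.
rewrite !addnS addn0 !RdeltaS //.
have := ray_ratio_ltS j.+1 l2; have := ray_ratio_ltS j.+2 l2.
have := ray_ratio_ltS j.+3 l2; have := ray_ratio_ltS j.+4 l2.
have := Rdelta_gt0 j l2.
move: x1; move: (ray_ratio l j.+1) (ray_ratio l j.+2) (ray_ratio l j.+3).
move: (ray_ratio l j.+4) (ray_ratio l j.+4.+1) (ray_ratio l m).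
move: (Rdelta l j) (Rdelta l m) => d e w u g x y z x1 d0 wu zw yz xy he ug E.
have u1 : x * u <= 1 - 2 * x ^+ 2 by nra.
have u2 : u <= 18/25 by nra.
have q0 : 9/20 < u - u ^+ 4.
  (* The chord of the square over [11/20, 18/25], used twice for u^4. *)
  have c2 : u ^+ 2 <= 127/100 * u - 99/250 by clear -x1 u2 xy yz zw wu; nra.
  have : u ^+ 4 <= (127/100 * u - 99/250) ^+ 2.
    by rewrite (exprM u 2 2) ler_pXn2r // nnegrE ?sqr_ge0 //; lra.
  by move: c2; lra.
have yzwu : y * z * w * u <= u ^+ 4.
  by rewrite !exprSr expr0 mul1r !ler_pM ?mulr_ge0 //; lra.
have q : 1 + y * z * w * u < x + u by lra.
have : 0 < d * (1 - x - x * y - x * (y * z * w * u)).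
  by apply: mulr_gt0 => //; nra.
by lra.
Qed.

(** With [2 x z <= 1 - x^2], which [E] implies, the claim reduces to
    [1 + x^4 < 2 x]. *)
Lemma not_cond1_j_j1_j3 (R : realType) (l : R) (j k m : nat) :
  2 <= l -> (0 < j)%N -> (j.+3 <= k)%N -> (j.+3 <= m)%N ->
  l = ray_ratio l j + ray_ratio l j.+1 + ray_ratio l k + ray_ratio l m ->
  0 < Rdelta l j - Rdelta l j.+1 - Rdelta l k - Rdelta l m.
Proof.
move=> l2 j0 jk jm hl; have x1 := first_ray_ratio_ge l2 j0 hl.
have := first_ray_ratio_eq l2 hl; have := ray_ratio_le l2 jm.
have := Rdelta_ge l2 jm.
have := ray_ratio_le l2 jk; have := Rdelta_ge l2 jk.
rewrite !RdeltaS //.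
have := ray_ratio_ltS j.+1 l2; have := ray_ratio_ltS j.+2 l2.
have := Rdelta_gt0 j l2.
move: x1; move: (ray_ratio l j.+1) (ray_ratio l j.+2) (ray_ratio l j.+3).
move: (ray_ratio l k) (ray_ratio l m) => a b.
move: (Rdelta l j) (Rdelta l k) (Rdelta l m) => d e f x y z.
move=> x1 d0 yz xy he za hf zb E.
have z1 : x ^+ 2 + 2 * x * z <= 1 by nra.
have s1 : 2 * x * z <= 1 - x ^+ 2 by lra.
(* The chord of the square over [11/20, 29/50], used twice for x^4. *)
have c2 : x ^+ 2 <= 113/100 * x - 319/1000 by clear -x1 z1 xy yz; nra.
have c4 : x ^+ 4 < 2 * x - 1.
  have : x ^+ 4 <= (113/100 * x - 319/1000) ^+ 2.
    by rewrite (exprM x 2 2) ler_pXn2r // nnegrE ?sqr_ge0 //; lra.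
  by move: c2; lra.
have q : x + 2 * x * y * z < 1.
  have : (2 * x * z) ^+ 2 <= (1 - x ^+ 2) ^+ 2.
    by rewrite ler_pXn2r // nnegrE ?mulr_ge0 //; nra.
  have : 2 * x * (2 * x * z) * y <= 2 * x * (2 * x * z) * z.
    by rewrite ler_pM2l ?mulr_gt0 //; lra.
  clear -x1 c4; nra.
have : 0 < d * (1 - x - 2 * x * y * z) by apply: mulr_gt0 => //; lra.
by lra.
Qed.

(** The borderline family: the eigenvalue equation is [3 x y = 1]. *)
Lemma cond1_j_j2 (R : realType) (l : R) (j : nat) :
  2 <= l ->
  l = ray_ratio l j + ray_ratio l j.+2 + ray_ratio l j.+2 + ray_ratio l j.+2 ->
  Rdelta l j = 3 * Rdelta l j.+2.
Proof.
move=> l2 /(first_ray_ratio_eq l2) E; rewrite !RdeltaS //.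
by rewrite -[LHS]mulr1 -[X in _ * X = _]E; ring.
Qed.

(** The equation gives [3 x y <= 1], and one of the three subtracted terms is
    strictly smaller than [delta j.+2]. *)
Lemma not_cond1_j_j2 (R : realType) (l : R) (j k m n : nat) :
  2 <= l -> (j.+2 <= k)%N -> (k <= m)%N -> (m <= n)%N -> (j.+2 < n)%N ->
  l = ray_ratio l j + ray_ratio l k + ray_ratio l m + ray_ratio l n ->
  0 < Rdelta l j - Rdelta l k - Rdelta l m - Rdelta l n.
Proof.
move=> l2 jk km mn jn /(first_ray_ratio_eq l2) E.
have := Rdelta_ge l2 jk; have := Rdelta_ge l2 (leq_trans jk km).
have := Rdelta_gt l2 jn; rewrite !RdeltaS //.
move: E; have := ray_ratio_le l2 jk; have := ray_ratio_le l2 (leq_trans jk km).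
have := ray_ratio_lt l2 jn; have := Rdelta_gt0 j l2.
have := ray_ratioS_gt0 j l2.
move: (ray_ratio l j.+1) (ray_ratio l j.+2) (Rdelta l j) => x y d.
move: (ray_ratio l k) (ray_ratio l m) (ray_ratio l n) => a b c.
move=> x0 d0 yc yb ya E *.
have q : 3 * (x * y) <= 1 by nra.
have : 0 <= d * (1 - 3 * (x * y)) by apply: mulr_ge0; lra.
by lra.
Qed.

(** * Classification *)

Lemma cond1_iff (R : realType) (l : R) (k1 k2 k3 k4 : nat) :
  2 <= l -> (0 < k1)%N -> (k1 <= k2)%N -> (k2 <= k3)%N -> (k3 <= k4)%N ->
  l = ray_ratio l k1 + ray_ratio l k2 + ray_ratio l k3 + ray_ratio l k4 ->
  Rdelta l k1 - Rdelta l k2 - Rdelta l k3 - Rdelta l k4 <= 0 <->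
  [\/ k2 = k1, k2 = k1.+1 /\ k3 = k1.+1,
      [/\ k2 = k1.+1, k3 = k1.+2 & (k4 <= k1 + 4)%N] |
      [/\ k2 = k1.+2, k3 = k1.+2 & k4 = k1.+2]].
Proof.
move=> l2 k0 k12 k23 k34 hl; split=> [|[->|[e2 e3]|[e2 e3 m4]|[e2 e3 e4]]].
- rewrite leNgt => /negP neg.
  have [e2|n2] := eqVneq k2 k1; first by constructor 1.
  have [e2|m2] := eqVneq k2 k1.+1.
    have [e3|n3] := eqVneq k3 k1.+1; first by constructor 2.
    have [e3|m3] := eqVneq k3 k1.+2.
      have [m4|m4] := leqP k4 (k1 + 4); first by constructor 3.
      by case: neg; subst k2 k3; apply: not_cond1_j_j1_j2 hl => //; lia.
    by case: neg; subst k2; apply: not_cond1_j_j1_j3 hl => //; lia.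
  have [e4|n4] := eqVneq k4 k1.+2; first by constructor 4; split; lia.
  by case: neg; apply: not_cond1_j_j2 hl => //; lia.
- have := Rdelta_gt0 k3 l2; have := Rdelta_gt0 k4 l2; lra.
- by subst k2 k3; apply: cond1_j_j1_j1 hl.
- subst k2 k3; have : [|| k4 == k1.+2, k4 == k1.+3 | k4 == k1.+4] by lia.
  case/or3P=> /eqP e4; subst k4.
  + exact: cond1_j_j1_j2_j2 hl.
  + exact: cond1_j_j1_j2_j3 hl.
  + exact: cond1_j_j1_j2_j4 hl.
- by subst k2 k3 k4; rewrite (cond1_j_j2 l2 hl); lra.
Qed.

Lemma cond12_iff (R : realType) (l : R) (k1 k2 k3 k4 : nat) :
  2 <= l -> (0 < k1)%N -> (k1 <= k2)%N -> (k2 <= k3)%N -> (k3 <= k4)%N ->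
  l = ray_ratio l k1 + ray_ratio l k2 + ray_ratio l k3 + ray_ratio l k4 ->
  Rdelta l k1 - Rdelta l k2 - Rdelta l k3 - Rdelta l k4 <= 0 /\
  0 <= Rdelta l k1 - Rdelta l k2 - Rdelta l k3 + Rdelta l k4 <->
  k2 = k1 /\ k4 = k3 \/
  [\/ [/\ k2 = k1.+1, k3 = k1.+1 & (k4 <= k1 + 3)%N],
      (k1, k2, k3, k4) = (1, 2, 2, 5)%N,
      [/\ k2 = k1.+1, k3 = k1.+2 & (k4 <= k1 + 4)%N] |
      [/\ k2 = k1.+2, k3 = k1.+2 & k4 = k1.+2]].
Proof.
move=> l2 k0 k12 k23 k34 hl; have c1 := cond1_iff l2 k0 k12 k23 k34 hl.
split.
  case=> /c1 + c2; case=> [e2|[e2 e3]|[e2 e3 m4]|[e2 e3 e4]].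
  - left; split=> //; apply/eqP; rewrite eqn_leq k34 andbT leqNgt.
    apply/negP => /(Rdelta_gt l2) d34; move: c2; rewrite e2; lra.
  - right; subst k2 k3.
    have [m4|m4] := leqP k4 (k1 + 3); first by constructor 1.
    have [m5|m5] := leqP (k1 + 5) k4.
      by move: c2; rewrite leNgt not_cond2_j_j1_j1_ge5.
    have [j2|j2] := leqP 2 k1.
      by move: c2; rewrite leNgt not_cond2_j_j1_j1_ge4 //; lia.
    by constructor 2; congr (_, _, _, _); lia.
  - by right; constructor 3.
  - by right; constructor 4.
move=> H; split.
  apply/c1; case: H => [[e2 _]|[[e2 e3 _]|[e1 e2 e3 e4]|H|H]].
  - by constructor 1.
  - by constructor 2.
  - by constructor 2; lia.
  - by constructor 3.
  - by constructor 4.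
case: H => [[-> ->]|[[e2 e3 m4]|[e1 e2 e3 e4]|[e2 e3 m4]|[e2 e3 e4]]].
- lra.
- by subst k2 k3; apply: cond2_j_j1_j1 hl => //; lia.
- by subst k1 k2 k3 k4; rewrite cond2_1225.
- by subst k2 k3; apply: cond2_j_j1_j2 hl.
- subst k2 k3 k4; rewrite (cond1_j_j2 l2 hl); have := Rdelta_gt0 k1.+2 l2; lra.
Qed.

Theorem mainTheorem7 (R : realType) (k1 k2 k3 k4 : nat) (lambda : R)
    (hk1 : (1 <= k1)%N) (hk12 : (k1 <= k2)%N) (hk23 : (k2 <= k3)%N)
    (hk34 : (k3 <= k4)%N)
    (hlambda : is_largest_eigenvalue (star4_matrix R k1 k2 k3 k4) lambda) :
  let delta (n : nat) : R := 1 / (Rpoly R n).[lambda] in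
  let cond1 := delta k1 - delta k2 - delta k3 - delta k4 <= 0 in
  let cond2 := 0 <= delta k1 - delta k2 - delta k3 + delta k4 in
  (cond1 <->
     (exists j k l : nat, [/\ (1 <= j)%N, (j <= k)%N, (k <= l)%N &
        (k1, k2, k3, k4) = (j, j, k, l)])
     \/ (exists j m : nat, [/\ (1 <= j)%N, (1 <= m)%N &
        (k1, k2, k3, k4) = (j, j + 1, j + 1, j + m)%N])
     \/ (exists j m : nat, [/\ (1 <= j)%N, (2 <= m <= 4)%N &
        (k1, k2, k3, k4) = (j, j + 1, j + 2, j + m)%N])
     \/ (exists j : nat, (1 <= j)%N /\
        (k1, k2, k3, k4) = (j, j + 2, j + 2, j + 2)%N))
  /\
  (cond1 /\ cond2 <->
     (exists j k : nat, [/\ (1 <= j)%N, (j <= k)%N &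
        (k1, k2, k3, k4) = (j, j, k, k)])
     \/ (exists j m : nat, [/\ (1 <= j)%N, (1 <= m <= 3)%N &
        (k1, k2, k3, k4) = (j, j + 1, j + 1, j + m)%N])
     \/ (k1, k2, k3, k4) = (1, 2, 2, 5)%N
     \/ (exists j m : nat, [/\ (1 <= j)%N, (2 <= m <= 4)%N &
        (k1, k2, k3, k4) = (j, j + 1, j + 2, j + m)%N])
     \/ (exists j : nat, (1 <= j)%N /\
        (k1, k2, k3, k4) = (j, j + 2, j + 2, j + 2)%N)).
Proof.
have k2p := leq_trans hk1 hk12; have k3p := leq_trans k2p hk23.
have k4p := leq_trans k3p hk34.
have [l2 hl] := star4_largest_eigenvalue hk1 k2p k3p k4p hlambda.
move=> delta cond1 cond2; split.
  apply: (iff_trans (cond1_iff l2 hk1 hk12 hk23 hk34 hl)); split.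
    case=> [->|[e2 e3]|[e2 e3 m4]|[-> -> ->]].
    - by left; exists k1, k3, k4; split=> //; apply: leq_trans hk23.
    - subst k2 k3; right; left; exists k1, (k4 - k1)%N.
      split=> //; first by lia.
      by congr (_, _, _, _); lia.
    - subst k2 k3; right; right; left; exists k1, (k4 - k1)%N.
      split=> //; first by lia.
      by congr (_, _, _, _); lia.
    - by right; right; right; exists k1; split=> //; congr (_, _, _, _); lia.
  case=> [[j [k [l [j1 jk kl [-> -> -> ->]]]]]|].
    by constructor 1.
  case=> [[j [m [j1 m1 [-> -> -> ->]]]]|]; first by constructor 2; lia.
  case=> [[j [m [j1 m1 [-> -> -> ->]]]]|[j [j1 [-> -> -> ->]]]].
    by constructor 3; split; lia.
  by constructor 4; split; lia.
apply: (iff_trans (cond12_iff l2 hk1 hk12 hk23 hk34 hl)); split.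
  case=> [[-> ->]|[[e2 e3 m4]|E|[e2 e3 m4]|[-> -> ->]]].
  - by left; exists k1, k3; split=> //; apply: leq_trans hk23.
  - subst k2 k3; right; left; exists k1, (k4 - k1)%N.
    split=> //; first by lia.
    by congr (_, _, _, _); lia.
  - by right; right; left.
  - subst k2 k3; right; right; right; left; exists k1, (k4 - k1)%N.
    split=> //; first by lia.
    by congr (_, _, _, _); lia.
  - right; right; right; right; exists k1; split=> //.
    by congr (_, _, _, _); lia.
case=> [[j [k [j1 jk [-> -> -> ->]]]]|]; first by left.
case=> [[j [m [j1 m1 [-> -> -> ->]]]]|].
  by right; constructor 1; split; lia.
case=> [->|]; first by right; constructor 2.
case=> [[j [m [j1 m1 [-> -> -> ->]]]]|[j [j1 [-> -> -> ->]]]].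
  by right; constructor 3; split; lia.
by right; constructor 4; split; lia.
Qed.
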